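(* Let $X$ be a Banach space over $\mathbb{K}$ ($=\mathbb{R}$ or $\mathbb{C}$). If $X^*$ has the $X$-AHp, then the pair $(X,\ell_\infty)$ has the BPBZp.
   Context: $S_X$ is the unit sphere of a Banach space $X$, $X^*$ its topological dual, $\mathcal{L}(X,Y)$ the bounded linear operators from $X$ to $Y$. $X$-AHp: $X^*$ has the $X$-AHp if for every $\varepsilon>0$ there is $\eta(\varepsilon)>0$ such that for every $x_0\in S_X$ there exists $x_1\in S_X$ satisfying (i) $\|x_1-x_0\|<\varepsilon$, and (ii) if $x_0^*\in S_{X^*}$ satisfies $\operatorname{Re}x_0^*(x_0)>1-\eta(\varepsilon)$, then there exists $x_1^*\in S_{X^*}$ such that $\|x_1^*-x_0^*\|<\varepsilon$ and $x_1^*(x_1)=1$. BPBZp (Bishop-Phelps-Bollobás-Zizler property): a pair $(X,Y)$ of Banach spaces has the BPBZp if for every $\varepsilon>0$ there exists $\eta(\varepsilon)>0$ such that whenever $T\in\mathcal{L}(X,Y)$ with $\|T\|=1$, $y_0^*\in S_{Y^*}$ and $x_0\in S_X$ satisfy $|y_0^*(Tx_0)|>1-\eta(\varepsilon)$, there exist $y_1^*\in S_{Y^*}$, $x_1\in S_X$ and $S\in\mathcal{L}(X,Y)$ with $\|S\|=|y_1^*(Sx_1)|=1$, $\|x_1-x_0\|<\varepsilon$, $\|y_1^*-y_0^*\|<\varepsilon$ and $\|S-T\|<\varepsilon$. *)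

(* Defs.v *)
From Stdlib Require Import Reals Lra FunctionalExtensionality
  PropExtensionality ProofIrrelevance ClassicalEpsilon.
From Coquelicot Require Import Coquelicot.
Open Scope R_scope.

Inductive scalars := RealScalars | ComplexScalars.

Definition scalar_field (k : scalars) : AbsRing :=
  match k with
  | RealScalars => R_AbsRing
  | ComplexScalars => C_AbsRing
  end.

Definition re (k : scalars) : scalar_field k -> R :=
  match k with
  | RealScalars => fun x : R => x
  | ComplexScalars => fun z : C => Re z
  end.
Arguments re {k} _.

(* The supremum is a real number only for a bounded operator: the junk value
   for an infinite supremum is 0, so [op_norm] is always used together with
   [is_linear], which in Coquelicot means linear and bounded. *)
Definition op_norm {K : AbsRing} {U V : NormedModule K} (T : U -> V) : R :=
  real (Lub_Rbar (fun r => exists x : U, norm x <= 1 /\ r = norm (T x))).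

Definition op_sub {K : AbsRing} {U V : NormedModule K} (S T : U -> V) : U -> V :=
  fun x => minus (S x) (T x).

Definition sphere {K : AbsRing} {X : NormedModule K} (x : X) : Prop :=
  norm x = 1.

Definition dual_sphere {K : AbsRing} {X : NormedModule K}
    (f : X -> AbsRing_NormedModule K) : Prop :=
  is_linear f /\ op_norm f = 1.

Definition AHp {k : scalars} (X : CompleteNormedModule (scalar_field k)) : Prop :=
  forall eps : R, 0 < eps ->
  exists eta : R, 0 < eta /\
  forall x0 : X, sphere x0 ->
  exists x1 : X, sphere x1 /\
    norm (minus x1 x0) < eps /\
    forall f0 : X -> AbsRing_NormedModule (scalar_field k),
      dual_sphere f0 -> re (f0 x0) > 1 - eta ->
      exists f1 : X -> AbsRing_NormedModule (scalar_field k),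
        dual_sphere f1 /\ op_norm (op_sub f1 f0) < eps /\ f1 x1 = one.

Definition BPBZp {K : AbsRing} (X Y : CompleteNormedModule K) : Prop :=
  forall eps : R, 0 < eps ->
  exists eta : R, 0 < eta /\
  forall (T : X -> Y) (g0 : Y -> AbsRing_NormedModule K) (x0 : X),
    is_linear T -> op_norm T = 1 -> dual_sphere g0 -> sphere x0 ->
    abs (g0 (T x0)) > 1 - eta ->
    exists (g1 : Y -> AbsRing_NormedModule K) (x1 : X) (S : X -> Y),
      dual_sphere g1 /\ sphere x1 /\ is_linear S /\
      op_norm S = 1 /\ abs (g1 (S x1)) = 1 /\
      norm (minus x1 x0) < eps /\
      op_norm (op_sub g1 g0) < eps /\
      op_norm (op_sub S T) < eps.

Definition bounded_seq {K : AbsRing} (u : nat -> K) : Prop :=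
  exists M : R, forall n, abs (u n) <= M.

Definition linf_sort (K : AbsRing) : Type := {u : nat -> K | bounded_seq u}.

Definition coord {K : AbsRing} (u : linf_sort K) : nat -> K := proj1_sig u.

Lemma linf_ext (K : AbsRing) (u v : linf_sort K) :
  (forall n, coord u n = coord v n) -> u = v.
Proof.
destruct u as [u Hu], v as [v Hv]; simpl; intros H.
assert (E : u = v) by (apply functional_extensionality; exact H).
subst v; f_equal; apply proof_irrelevance.
Qed.

Lemma bounded_zero (K : AbsRing) : bounded_seq (fun _ : nat => zero : K).
Proof. exists 0; intros _; rewrite abs_zero; lra. Qed.

Lemma bounded_plus (K : AbsRing) (u v : nat -> K) :
  bounded_seq u -> bounded_seq v -> bounded_seq (fun n => plus (u n) (v n)).
Proof.
intros [M HM] [N HN]; exists (M + N); intros n.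
generalize (abs_triangle (u n) (v n)) (HM n) (HN n); lra.
Qed.

Lemma bounded_scal (K : AbsRing) (a : K) (u : nat -> K) :
  bounded_seq u -> bounded_seq (fun n => mult a (u n)).
Proof.
intros [M HM]; exists (abs a * M); intros n.
apply Rle_trans with (1 := abs_mult _ _).
apply Rmult_le_compat_l; [apply abs_ge_0 | apply HM].
Qed.

Lemma bounded_opp (K : AbsRing) (u : nat -> K) :
  bounded_seq u -> bounded_seq (fun n => opp (u n)).
Proof. intros [M HM]; exists M; intros n; rewrite abs_opp; apply HM. Qed.

Definition linf_zero (K : AbsRing) : linf_sort K := exist _ _ (bounded_zero K).
Definition linf_plus {K : AbsRing} (u v : linf_sort K) : linf_sort K :=
  exist _ _ (bounded_plus K _ _ (proj2_sig u) (proj2_sig v)).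
Definition linf_opp {K : AbsRing} (u : linf_sort K) : linf_sort K :=
  exist _ _ (bounded_opp K _ (proj2_sig u)).
Definition linf_scal {K : AbsRing} (a : K) (u : linf_sort K) : linf_sort K :=
  exist _ _ (bounded_scal K a _ (proj2_sig u)).
Definition linf_norm {K : AbsRing} (u : linf_sort K) : R :=
  real (Lub_Rbar (fun r => exists n, r = abs (coord u n))).
Definition linf_ball {K : AbsRing} (u : linf_sort K) (e : R) (v : linf_sort K) : Prop :=
  linf_norm (linf_plus v (linf_opp u)) < e.

Lemma linf_norm_lub (K : AbsRing) (u : linf_sort K) :
  is_lub (fun r => exists n, r = abs (coord u n)) (linf_norm u).
Proof.
unfold linf_norm.
destruct (Lub_Rbar_correct (fun r => exists n, r = abs (coord u n))) as [H1 H2].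
destruct (proj2_sig u) as [M HM]; fold (coord u) in HM.
assert (Hub : is_ub_Rbar (fun r => exists n, r = abs (coord u n)) M).
{ intros r [n ->]; apply HM. }
assert (H3 := H1 _ (ex_intro _ 0%nat eq_refl)).
assert (H4 := H2 _ Hub).
destruct (Lub_Rbar _) as [l| |]; simpl in *; try contradiction.
split.
- intros r Hr; exact (H1 r Hr).
- intros b Hb; apply (H2 (Finite b)); intros r Hr; exact (Hb r Hr).
Qed.

Lemma coord_le_norm (K : AbsRing) (u : linf_sort K) n : abs (coord u n) <= linf_norm u.
Proof. apply (proj1 (linf_norm_lub K u)); now exists n. Qed.

Lemma linf_norm_le (K : AbsRing) (u : linf_sort K) (M : R) :
  (forall n, abs (coord u n) <= M) -> linf_norm u <= M.
Proof. intros H; apply (proj2 (linf_norm_lub K u)); intros r [n ->]; apply H. Qed.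

Definition linf_AbelianMonoid_mixin (K : AbsRing) : AbelianMonoid.mixin_of (linf_sort K).
Proof.
apply (AbelianMonoid.Mixin (linf_sort K) linf_plus (linf_zero K));
  intros; apply linf_ext; intros n; simpl.
- apply plus_comm.
- apply plus_assoc.
- apply plus_zero_r.
Defined.

Canonical linf_AbelianMonoid (K : AbsRing) : AbelianMonoid :=
  AbelianMonoid.Pack (linf_sort K) (linf_AbelianMonoid_mixin K) (linf_sort K).

Definition linf_AbelianGroup_mixin (K : AbsRing) :
  AbelianGroup.mixin_of (linf_AbelianMonoid K).
Proof.
apply (AbelianGroup.Mixin (linf_AbelianMonoid K) linf_opp).
intros u; apply linf_ext; intros n; apply (plus_opp_r (coord u n)).
Defined.

Canonical linf_AbelianGroup (K : AbsRing) : AbelianGroup :=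
  AbelianGroup.Pack (linf_sort K)
    (AbelianGroup.Class (linf_sort K) (linf_AbelianMonoid_mixin K)
      (linf_AbelianGroup_mixin K)) (linf_sort K).

Definition linf_ModuleSpace_mixin (K : AbsRing) :
  ModuleSpace.mixin_of K (linf_AbelianGroup K).
Proof.
apply (ModuleSpace.Mixin K (linf_AbelianGroup K) linf_scal);
  intros; apply linf_ext; intros n; simpl.
- apply mult_assoc.
- apply mult_one_l.
- exact (mult_distr_l (K := K) _ _ _).
- exact (mult_distr_r (K := K) _ _ _).
Defined.

Canonical linf_ModuleSpace (K : AbsRing) : ModuleSpace K :=
  ModuleSpace.Pack K (linf_sort K)
    (ModuleSpace.Class K (linf_sort K) (AbelianGroup.class (linf_AbelianGroup K))
      (linf_ModuleSpace_mixin K)) (linf_sort K).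

Lemma coord_sub (K : AbsRing) (u v : linf_sort K) n :
  coord (linf_plus u (linf_opp v)) n = minus (coord u n) (coord v n).
Proof. reflexivity. Qed.

Lemma coord_sub_le (K : AbsRing) (u v : linf_sort K) n :
  abs (minus (coord u n) (coord v n)) <= linf_norm (linf_plus u (linf_opp v)).
Proof. rewrite <- coord_sub; apply coord_le_norm. Qed.

Lemma abs_minus_sym (K : AbsRing) (x y : K) : abs (minus x y) = abs (minus y x).
Proof. rewrite <- abs_opp; f_equal; apply opp_minus. Qed.

Lemma abs_minus_triangle (K : AbsRing) (x y z : K) :
  abs (minus x z) <= abs (minus x y) + abs (minus y z).
Proof. rewrite (minus_trans y x z); apply abs_triangle. Qed.

Definition linf_UniformSpace_mixin (K : AbsRing) : UniformSpace.mixin_of (linf_sort K).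
Proof.
apply (UniformSpace.Mixin (linf_sort K) (linf_zero K) linf_ball); unfold linf_ball.
- intros u e; apply Rle_lt_trans with 0; [| apply cond_pos].
  apply linf_norm_le; intros n.
  rewrite coord_sub, minus_eq_zero; apply Req_le; exact (@abs_zero K).
- intros u v e; apply Rle_lt_trans.
  apply linf_norm_le; intros n.
  rewrite coord_sub, abs_minus_sym; apply coord_sub_le.
- intros u v w e1 e2 H1 H2.
  apply Rle_lt_trans with (2 := Rplus_lt_compat _ _ _ _ H1 H2).
  apply linf_norm_le; intros n; rewrite coord_sub.
  generalize (coord_sub_le K v u n) (coord_sub_le K w v n)
    (abs_minus_triangle K (coord w n) (coord v n) (coord u n)); lra.
Defined.

Canonical linf_UniformSpace (K : AbsRing) : UniformSpace :=
  UniformSpace.Pack (linf_sort K) (linf_UniformSpace_mixin K) (linf_sort K).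

Canonical linf_NormedModuleAux (K : AbsRing) : NormedModuleAux K :=
  NormedModuleAux.Pack K (linf_sort K)
    (NormedModuleAux.Class K (linf_sort K)
      (ModuleSpace.class K (linf_ModuleSpace K)) (linf_UniformSpace_mixin K))
    (linf_sort K).

Definition linf_NormedModule_mixin (K : AbsRing) :
  NormedModule.mixin_of K (linf_NormedModuleAux K).
Proof.
apply (NormedModule.Mixin K (linf_NormedModuleAux K) linf_norm 1).
- intros u v; apply linf_norm_le; intros n; simpl.
  generalize (abs_triangle (coord u n) (coord v n))
    (coord_le_norm K u n) (coord_le_norm K v n).
  unfold coord; simpl; lra.
- intros a u; apply linf_norm_le; intros n; simpl.
  apply Rle_trans with (1 := abs_mult _ _).
  apply Rmult_le_compat_l; [apply abs_ge_0 | apply coord_le_norm].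
- intros u v e H; exact H.
- intros u v e H; rewrite Rmult_1_l; exact H.
- intros u H; apply linf_ext; intros n; apply abs_eq_zero.
  apply Rle_antisym; [rewrite <- H; apply coord_le_norm | apply abs_ge_0].
Defined.

Canonical linf_NormedModule (K : AbsRing) : NormedModule K :=
  NormedModule.Pack K (linf_sort K)
    (NormedModule.Class K (linf_sort K)
      (NormedModuleAux.class K (linf_NormedModuleAux K))
      (linf_NormedModule_mixin K)) (linf_sort K).

Lemma scalar_complete (k : scalars)
    (F : (AbsRing_UniformSpace (scalar_field k) -> Prop) -> Prop) :
  ProperFilter F -> cauchy F ->
  exists x : AbsRing_UniformSpace (scalar_field k),
    forall eps : posreal, F (ball x eps).
Proof.
destruct k; simpl in F |- *; intros HF HC.
- exists (R_complete_lim F); exact (R_complete F HF HC).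
- exists (C_complete_lim F : C); intros eps.
  assert (HC' : forall e : posreal,
            exists x : C_UniformSpace, F (@ball C_UniformSpace x e)).
  { intros e; destruct (HC e) as [x Hx]; exists x.
    apply (filter_imp (F := F)) with (2 := Hx); intros y Hy.
    exact (C_NormedModule_mixin_compat1 x y e Hy). }
  destruct (proj2 (locally_C (C_complete_lim F : C)
    (@ball (AbsRing_UniformSpace C_AbsRing) (C_complete_lim F : C) eps)))
    as [d Hd]; [now exists eps |].
  apply (filter_imp (F := F)) with (1 := Hd).
  exact (C_complete_ax1 F HF HC' d).
Qed.

Lemma linf_complete (k : scalars)
    (F : (linf_UniformSpace (scalar_field k) -> Prop) -> Prop) :
  ProperFilter F -> cauchy F ->
  exists u : linf_UniformSpace (scalar_field k),
    forall eps : posreal, F (ball u eps).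
Proof.
intros HF HC.
set (K := scalar_field k) in *.
assert (Hn : forall n, exists x : K, forall eps : posreal,
          F (fun u => abs (minus (coord u n) x) < eps)).
{ intros n.
  apply (scalar_complete k (fun P => F (fun u => P (coord u n)))).
  - split.
    + intros P HP; destruct (filter_ex (F := F) _ HP) as [u Hu]; now exists (coord u n).
    + split.
      * apply filter_true.
      * intros P Q HP HQ; exact (filter_and (F := F) _ _ HP HQ).
      * intros P Q HPQ HP; apply (filter_imp (F := F)) with (2 := HP); auto.
  - intros eps; destruct (HC eps) as [u Hu]; exists (coord u n).
    apply (filter_imp (F := F)) with (2 := Hu); intros v Hv.
    exact (Rle_lt_trans _ _ _ (coord_le_norm K (linf_plus v (linf_opp u)) n) Hv). }
set (l := fun n => proj1_sig (constructive_indefinite_description _ (Hn n))).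
assert (Hl : forall n (eps : posreal), F (fun u => abs (minus (coord u n) (l n)) < eps)).
{ intros n; exact (proj2_sig (constructive_indefinite_description _ (Hn n))). }
assert (Hc : forall (eps : posreal) (v : linf_sort K), F (ball v eps) ->
          forall n, abs (minus (l n) (coord v n)) <= eps).
{ intros eps v Hv n; apply le_epsilon; intros d Hd.
  destruct (filter_ex (F := F) _ (filter_and (F := F) _ _ Hv (Hl n (mkposreal d Hd))))
    as [u [Hu1 Hu2]]; simpl in Hu2.
  generalize (coord_sub_le K u v n)
    (abs_minus_triangle K (l n) (coord u n) (coord v n)).
  unfold ball in Hu1; simpl in Hu1; unfold linf_ball in Hu1.
  rewrite abs_minus_sym in Hu2; lra. }
assert (Hb : bounded_seq l).
{ destruct (HC (mkposreal 1 Rlt_0_1)) as [v Hv].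
  destruct (proj2_sig v) as [M HM]; exists (1 + M); intros n.
  assert (H : l n = plus (minus (l n) (coord v n)) (coord v n)).
  { unfold minus; rewrite <- plus_assoc, plus_opp_l; symmetry; apply plus_zero_r. }
  rewrite H; apply Rle_trans with (1 := abs_triangle _ _).
  apply Rplus_le_compat; [apply (Hc _ v Hv) | apply HM]. }
exists (exist _ l Hb : linf_sort K); intros eps.
destruct (HC (pos_div_2 (pos_div_2 eps))) as [v Hv].
apply (filter_imp (F := F)) with (2 := Hv); intros u Hu.
unfold ball in *; simpl in *; unfold linf_ball in *.
apply Rle_lt_trans with (eps / 2 / 2 + eps / 2 / 2); [| generalize (cond_pos eps); lra].
apply linf_norm_le; intros n; rewrite coord_sub; simpl.
generalize (Hc (pos_div_2 (pos_div_2 eps)) v Hv n) (coord_sub_le K u v n)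
  (abs_minus_triangle K (coord u n) (coord v n) (l n)); simpl.
rewrite (abs_minus_sym K (l n)); lra.
Qed.

Definition linf_lim (k : scalars)
    (F : (linf_UniformSpace (scalar_field k) -> Prop) -> Prop) :
    linf_UniformSpace (scalar_field k) :=
  epsilon (inhabits (linf_zero (scalar_field k)))
    (fun u : linf_UniformSpace (scalar_field k) => forall eps : posreal, F (ball u eps)).

Definition linf_CompleteSpace_mixin (k : scalars) :
  CompleteSpace.mixin_of (linf_UniformSpace (scalar_field k)).
Proof.
apply (CompleteSpace.Mixin _ (linf_lim k)).
- intros F HF HC; unfold linf_lim; apply epsilon_spec; now apply linf_complete.
- intros F1 F2 H12 H21.
  replace F2 with F1; [intros eps; apply ball_center |].
  apply functional_extensionality; intros P; apply propositional_extensionality.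
  split; [apply H21 | apply H12].
Defined.

Definition linf (k : scalars) : CompleteNormedModule (scalar_field k) :=
  CompleteNormedModule.Pack (scalar_field k) (linf_sort (scalar_field k))
    (CompleteNormedModule.Class (scalar_field k) (linf_sort (scalar_field k))
      (NormedModule.class (scalar_field k) (linf_NormedModule (scalar_field k)))
      (linf_CompleteSpace_mixin k)) (linf_sort (scalar_field k)).

(* Main.v *)
Require Import Defs.
From Stdlib Require Import Reals Lra ClassicalEpsilon.
From Coquelicot Require Import Coquelicot.
Open Scope R_scope.

(** Write [T x = (f_n x)_n] and let [A] be the set of [n] with [|f_n x0|] close
    to 1. For [n] in [A] the AHp, applied to a normalized rotation of [f_n], gives
    [h_n] near [f_n] with [|h_n x1| = 1] for one and the same [x1]; replacing
    [f_n] by [h_n] on [A] yields [S]. The functional [g0] nearly vanishes on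
    sequences supported off [A], and after multiplication by the phases of
    [S x1] on [A] it becomes a functional [phi] of norm at most 1 with
    [Re (phi 1)] close to 1. Such a [phi] is close to the normalized positive
    part of its real part, a functional of norm 1 taking the value 1 at the
    constant sequence 1. Undoing the phases gives the required functional. *)

(** * Real and complex scalars *)

Definition of_R (k : scalars) : R -> scalar_field k :=
  match k with RealScalars => fun x : R => x | ComplexScalars => RtoC end.
Arguments of_R {k} _.

Definition im (k : scalars) : scalar_field k -> R :=
  match k with RealScalars => fun _ => 0 | ComplexScalars => fun z : C => Im z end.
Arguments im {k} _.

(* With [0] as the real "imaginary unit", [z = re z + I * im z] holds over both
   fields, which allows one argument for the two cases. *)
Definition imag_unit (k : scalars) : scalar_field k :=
  match k with RealScalars => 0 | ComplexScalars => Ci end.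
Arguments imag_unit {k}.

Section Scalars.
Context {k : scalars}.
Notation K := (scalar_field k).
Implicit Types (z w : K) (x y : R).

Lemma mult_scalar_comm z w : mult z w = mult w z.
Proof. destruct k; [exact (Rmult_comm z w) | exact (Cmult_comm z w)]. Qed.

Lemma abs_mult_eq z w : abs (mult z w) = abs z * abs w.
Proof. destruct k; [exact (Rabs_mult z w) | exact (Cmod_mult z w)]. Qed.

Lemma of_R_plus x y : of_R (k:=k) (x + y) = plus (of_R x) (of_R y).
Proof. destruct k; [reflexivity | exact (RtoC_plus x y)]. Qed.

Lemma of_R_mult x y : of_R (k:=k) (x * y) = mult (of_R x) (of_R y).
Proof. destruct k; [reflexivity | exact (RtoC_mult x y)]. Qed.

Lemma of_R_1 : of_R (k:=k) 1 = one.
Proof. destruct k; reflexivity. Qed.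

Lemma of_R_minus x y : of_R (k:=k) (x - y) = minus (of_R x) (of_R y).
Proof. destruct k; [reflexivity | exact (RtoC_minus x y)]. Qed.

Lemma abs_of_R x : abs (of_R (k:=k) x) = Rabs x.
Proof. destruct k; [reflexivity | exact (Cmod_R x)]. Qed.

Lemma re_of_R x : re (of_R (k:=k) x) = x.
Proof. destruct k; reflexivity. Qed.

Lemma im_of_R x : im (of_R (k:=k) x) = 0.
Proof. destruct k; reflexivity. Qed.

Lemma re_add z w : re (plus z w) = re z + re w.
Proof. destruct k; reflexivity. Qed.

Lemma im_add z w : im (plus z w) = im z + im w.
Proof. destruct k; [exact (eq_sym (Rplus_0_r 0)) | reflexivity]. Qed.

Lemma re_neg z : re (opp z) = - re z.
Proof. destruct k; reflexivity. Qed.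

Lemma re_mul z w : re (mult z w) = re z * re w - im z * im w.
Proof. destruct k; [change (z * w = z * w - 0 * 0); ring | reflexivity]. Qed.

Lemma im_mul z w : im (mult z w) = re z * im w + im z * re w.
Proof. destruct k; [change (0 = z * 0 + 0 * w); ring | reflexivity]. Qed.

Lemma re_imag_mult z : re (mult imag_unit z) = - im z.
Proof. destruct k; [change (0 * z = - 0); ring |].
destruct z; unfold mult; simpl; unfold Cmult; simpl; ring. Qed.

Lemma scalar_decomp z : z = plus (of_R (re z)) (mult imag_unit (of_R (im z))).
Proof.
destruct k.
- change ((z : R) = z + 0 * 0 :> R); ring.
- destruct z; unfold plus, mult; simpl; unfold Cplus, Cmult; simpl.
  f_equal; ring.
Qed.

(** This is the identity behind scalar homogeneity of a complexified real functional. Over the reals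
    both sides are [z * x], since [im] and [imag_unit] vanish. *)
Lemma mult_decomp z x y :
  plus (of_R (re z * x - im z * y))
       (mult imag_unit (of_R (re z * y + im z * x))) =
  mult z (plus (of_R x) (mult imag_unit (of_R y))).
Proof.
destruct k.
- change (z * x - 0 * y + 0 * (z * y + 0 * x) = z * (x + 0 * y) :> R); ring.
- destruct z; unfold plus, mult; simpl; unfold Cplus, Cmult; simpl.
  f_equal; ring.
Qed.

Lemma abs_re z : Rabs (re z) <= abs z.
Proof. destruct k; [apply Rle_refl | exact (re_le_Cmod z)]. Qed.

Lemma abs_im z : Rabs (im z) <= abs z.
Proof.
destruct k; [simpl; rewrite Rabs_R0; apply Rabs_pos |].
exact (Rle_trans _ _ _ (Rmax_r _ _) (Rmax_Cmod z)).
Qed.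

Lemma abs_imag_unit : abs (imag_unit (k:=k)) <= 1.
Proof.
destruct k; simpl.
- change (Rabs 0 <= 1); rewrite Rabs_R0; lra.
- change (Cmod Ci <= 1); rewrite Cmod_Ci; lra.
Qed.

(** Over the complex numbers the modulus is the square root of [1 + x * x], while the square of the
    right side is [1 + x^2 + x^4 / 4]; over the reals the left side is 1. What matters later is that
    the excess over 1 is quadratic in [x]. *)
Lemma abs_one_plus_imag x :
  abs (plus one (mult (imag_unit (k:=k)) (of_R x))) <= 1 + x * x / 2.
Proof.
destruct k; simpl.
- change (Rabs (1 + 0 * x) <= 1 + x * x / 2).
  rewrite Rmult_0_l, Rplus_0_r, Rabs_R1; nra.
- change (Cmod (RtoC 1 + Ci * RtoC x)%C <= 1 + x * x / 2).
  unfold Cmod; rewrite <- (sqrt_Rsqr (1 + x * x / 2)) by nra.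
  apply sqrt_le_1_alt; simpl; unfold Rsqr; nra.
Qed.

Lemma scalar_phase z : exists w, abs w = 1 /\ mult w z = of_R (abs z).
Proof.
destruct k; simpl in *.
- destruct (Rle_dec 0 z) as [H|H].
  + exists 1; split; [exact Rabs_R1 |].
    change (1 * z = Rabs z); rewrite Rabs_pos_eq; lra.
  + exists (-1); split; [change (Rabs (-1) = 1); rewrite Rabs_left; lra |].
    change (-1 * z = Rabs z); rewrite Rabs_left; lra.
- destruct (Ceq_dec z 0) as [->|H].
  + exists (RtoC 1); split; [exact Cmod_1 |].
    change ((1 * 0)%C = RtoC (Cmod 0)); rewrite Cmod_0; ring.
  + assert (H0 : Cmod z <> 0) by (intros E; apply H, Cmod_eq_0, E).
    assert (H1 : RtoC (Cmod z) <> 0) by (intros E; apply H0, RtoC_inj, E).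
    exists (RtoC (Cmod z) / z)%C; split.
    * change (Cmod (RtoC (Cmod z) / z) = 1).
      rewrite Cmod_div, Cmod_R, Rabs_pos_eq by (auto; apply Cmod_ge_0).
      now field.
    * change ((RtoC (Cmod z) / z * z)%C = RtoC (Cmod z)). now field.
Qed.

Lemma unimodular_inv z : abs z = 1 -> exists w, abs w = 1 /\ mult w z = one.
Proof.
intros H; destruct (scalar_phase z) as [w [Hw E]].
exists w; split; [exact Hw |]; rewrite E, H; apply of_R_1.
Qed.

End Scalars.

(** A nonempty set bounded above has a finite supremum, so [real] never meets the infinite values
    that it would turn into 0. *)
Lemma real_Lub_is_lub (E : R -> Prop) (M : R) :
  (exists r, E r) -> (forall r, E r -> r <= M) -> is_lub E (real (Lub_Rbar E)).
Proof.
intros [r0 H0] HM.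
destruct (Lub_Rbar_correct E) as [H1 H2].
specialize (H1 r0 H0) as H3.
specialize (H2 (Finite M) HM) as H4.
destruct (Lub_Rbar E) as [l| |]; simpl in *; try contradiction.
split; [exact H1 |]; intros b Hb; exact (H2 (Finite b) Hb).
Qed.

(** * Operator norms *)

Section OperatorNorm.
Context {k : scalars} {U V : NormedModule (scalar_field k)}.
Implicit Types T : U -> V.

Lemma op_norm_le T (M : R) :
  (forall x, norm x <= 1 -> norm (T x) <= M) -> op_norm T <= M.
Proof.
intros H.
apply (real_Lub_is_lub _ M); [| now intros r [x [Hx ->]]; apply H ..].
exists (norm (T zero)), zero; split; [rewrite norm_zero; lra | reflexivity].
Qed.

Lemma norm_normalize (x : U) :
  norm x <> 0 -> norm (scal (of_R (/ norm x)) x) <= 1.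
Proof.
intros H; apply Rle_trans with (1 := norm_scal _ _).
rewrite abs_of_R, Rabs_pos_eq, Rinv_l by
  (auto; apply Rlt_le, Rinv_0_lt_compat; generalize (norm_ge_0 x); lra).
lra.
Qed.

(** The bound contained in [is_linear] makes the supremum finite, hence an upper bound on the unit
    ball; homogeneity carries it to all vectors. A vector of norm 0 cannot be normalized, but it is
    [zero]. *)
Lemma op_norm_ub T x : is_linear T -> norm (T x) <= op_norm T * norm x.
Proof.
intros HT.
assert (Hu : forall y, norm y <= 1 -> norm (T y) <= op_norm T).
{ intros y Hy; destruct (linear_norm T HT) as [M [HM H]].
  apply (real_Lub_is_lub (fun r => exists x, norm x <= 1 /\ r = norm (T x)) M).
  - exists (norm (T y)); now exists y.
  - intros r [z [Hz ->]]; generalize (H z) (norm_ge_0 z); nra.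
  - now exists y. }
destruct (Req_dec (norm x) 0) as [H|H].
- rewrite (norm_eq_zero x H), (linear_zero T HT), !norm_zero; lra.
- assert (E : T x = scal (of_R (norm x)) (T (scal (of_R (/ norm x)) x))).
  { rewrite (linear_scal T HT), scal_assoc, <- of_R_mult, Rinv_r, of_R_1 by exact H.
    symmetry; exact (scal_one (T x)). }
  rewrite E; apply Rle_trans with (1 := norm_scal _ _).
  rewrite abs_of_R, Rabs_pos_eq, Rmult_comm by apply norm_ge_0.
  apply Rmult_le_compat_r; [apply norm_ge_0 |].
  apply Hu, norm_normalize, H.
Qed.

Lemma op_norm_eq_1 T x :
  is_linear T -> (forall y, norm (T y) <= norm y) -> norm x = 1 -> norm (T x) = 1 ->
  op_norm T = 1.
Proof.
intros HT H Hx HTx; apply Rle_antisym.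
- apply op_norm_le; intros y Hy; generalize (H y); lra.
- generalize (op_norm_ub T x HT); rewrite Hx, HTx; lra.
Qed.

End OperatorNorm.

(** * Coordinatewise operations on bounded sequences *)

Section Coordinates.
Context {K : AbsRing}.
Implicit Types u v : linf_NormedModule K.

Lemma coord_plus u v n : coord (plus u v) n = plus (coord u n) (coord v n).
Proof. reflexivity. Qed.

Lemma coord_scal (c : K) u n : coord (scal c u) n = mult c (coord u n).
Proof. reflexivity. Qed.

Lemma coord_minus u v n : coord (minus u v) n = minus (coord u n) (coord v n).
Proof. reflexivity. Qed.

Lemma bounded_one : bounded_seq (fun _ : nat => one : K).
Proof. exists (abs (one : K)); intros _; apply Rle_refl. Qed.

Definition linf_one : linf_NormedModule K := exist _ _ bounded_one.

End Coordinates.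

(** * Positive part of a functional on real bounded sequences *)

Section PositivePart.
Notation V := (linf_NormedModule R_AbsRing).
Implicit Types a b c z : V.

(* Retyping coordinates from [R_AbsRing] to [R] makes [ring] and [lra] applicable. *)
Definition rcoord (a : V) (n : nat) : R := coord a n.

Notation nonneg a := (forall n, 0 <= rcoord a n).

Lemma real_ext a b : (forall n, rcoord a n = rcoord b n) -> a = b.
Proof. exact (linf_ext R_AbsRing a b). Qed.

Lemma real_coord_plus a b n : rcoord (plus a b) n = rcoord a n + rcoord b n.
Proof. reflexivity. Qed.

Lemma real_coord_minus a b n : rcoord (minus a b) n = rcoord a n - rcoord b n.
Proof. reflexivity. Qed.

Lemma real_coord_scal (t : R) a n : rcoord (scal t a) n = t * rcoord a n.
Proof. reflexivity. Qed.

(** The growth condition on [f] keeps the resulting sequence bounded; the lattice operations max and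
    min are both instances. *)
Definition seq_map2 (f : R -> R -> R)
    (Hf : forall x y, Rabs (f x y) <= Rabs x + Rabs y) a b : V.
Proof.
exists (fun n => f (rcoord a n) (rcoord b n)).
exists (linf_norm a + linf_norm b); intros n.
apply Rle_trans with (1 := Hf _ _), Rplus_le_compat;
  exact (coord_le_norm R_AbsRing _ n).
Defined.

Lemma Rmax_abs x y : Rabs (Rmax x y) <= Rabs x + Rabs y.
Proof.
generalize (Rabs_pos x) (Rabs_pos y); unfold Rmax; destruct Rle_dec; lra.
Qed.

Lemma Rmin_abs x y : Rabs (Rmin x y) <= Rabs x + Rabs y.
Proof.
generalize (Rabs_pos x) (Rabs_pos y); unfold Rmin; destruct Rle_dec; lra.
Qed.

Definition seq_max : V -> V -> V := seq_map2 Rmax Rmax_abs.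
Definition seq_min : V -> V -> V := seq_map2 Rmin Rmin_abs.

Lemma seq_min_coord a b n : rcoord (seq_min a b) n = Rmin (rcoord a n) (rcoord b n).
Proof. reflexivity. Qed.

Lemma coord_zero n : rcoord (zero : V) n = 0.
Proof. reflexivity. Qed.

Lemma coord_one n : rcoord (linf_one : V) n = 1.
Proof. reflexivity. Qed.

Variable L : V -> R.
Hypothesis L_plus : forall a b, L (plus a b) = L a + L b.
Hypothesis L_scal : forall (t : R) a, L (scal t a) = t * L a.
Hypothesis L_bound : forall a, Rabs (L a) <= norm a.

Definition between0 a z : Prop := forall n, 0 <= rcoord z n <= rcoord a n.

(** The Riesz-Kantorovich formula: on nonnegative sequences this is the positive part of [L] in the
    order dual. For other [a] the value is junk. *)
Definition pos_sup a : R :=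
  real (Lub_Rbar (fun r => exists z, between0 a z /\ r = L z)).

Lemma L_zero : L zero = 0.
Proof.
replace (zero : V) with (scal 0 zero : V) by exact (scal_zero_l _).
rewrite L_scal; apply Rmult_0_l.
Qed.

Lemma L_between0 a z : between0 a z -> L z <= norm a.
Proof.
intros Hz; apply Rle_trans with (norm z).
- generalize (L_bound z) (Rle_abs (L z)); lra.
- apply (linf_norm_le R_AbsRing); intros n.
  apply Rle_trans with (2 := coord_le_norm R_AbsRing a n).
  destruct (Hz n); change (Rabs (rcoord z n) <= Rabs (rcoord a n)).
  rewrite !Rabs_pos_eq; lra.
Qed.

Lemma pos_sup_lub a : nonneg a ->
  is_lub (fun r => exists z, between0 a z /\ r = L z) (pos_sup a).
Proof.
intros Ha; apply real_Lub_is_lub with (norm a).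
- exists (L zero), zero; split; [| reflexivity].
  intros n; rewrite coord_zero; generalize (Ha n); lra.
- intros r [z [Hz ->]]; now apply L_between0.
Qed.

Lemma pos_sup_ub a z : nonneg a -> between0 a z -> L z <= pos_sup a.
Proof. intros Ha Hz; apply (pos_sup_lub a Ha); now exists z. Qed.

Lemma pos_sup_le a M : nonneg a ->
  (forall z, between0 a z -> L z <= M) -> pos_sup a <= M.
Proof. intros Ha H; apply (pos_sup_lub a Ha); intros r [z [Hz ->]]; auto. Qed.

Lemma pos_sup_ge a : nonneg a -> 0 <= pos_sup a /\ L a <= pos_sup a.
Proof.
intros Ha; split; [rewrite <- L_zero |]; apply pos_sup_ub; auto; intros n;
  rewrite ?coord_zero; generalize (Ha n); lra.
Qed.

Lemma pos_sup_zero : pos_sup zero = 0.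
Proof.
assert (H : nonneg (zero : V)) by (intros n; rewrite coord_zero; lra).
apply Rle_antisym; [| apply (pos_sup_ge zero H)].
apply pos_sup_le; auto; intros z Hz.
rewrite <- (@norm_zero _ V); now apply L_between0.
Qed.

(** Riesz decomposition: a sequence [z] between 0 and [a + b] splits into [min z a], which lies
    below [a], and a remainder below [b]. Conversely, sums of elements of the two order intervals
    lie in the interval of the sum. *)
Lemma pos_sup_plus a b : nonneg a -> nonneg b ->
  pos_sup (plus a b) = pos_sup a + pos_sup b.
Proof.
intros Ha Hb.
assert (Hab : nonneg (plus a b)).
{ intros n; rewrite real_coord_plus; generalize (Ha n) (Hb n); lra. }
apply Rle_antisym.
- apply pos_sup_le; auto; intros z Hz.
  assert (E : z = plus (seq_min z a) (minus z (seq_min z a))).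
  { apply real_ext; intros n; rewrite real_coord_plus, real_coord_minus; ring. }
  rewrite E, L_plus; apply Rplus_le_compat; apply pos_sup_ub; auto; intros n;
    specialize (Hz n); rewrite real_coord_plus in Hz;
    rewrite ?real_coord_minus, !seq_min_coord;
    unfold Rmin; destruct Rle_dec; generalize (Ha n) (Hb n); lra.
- enough (H : pos_sup a <= pos_sup (plus a b) - pos_sup b) by lra.
  apply pos_sup_le; auto; intros z Hz.
  enough (H : pos_sup b <= pos_sup (plus a b) - L z) by lra.
  apply pos_sup_le; auto; intros w Hw.
  enough (H : L (plus z w) <= pos_sup (plus a b)) by (rewrite L_plus in H; lra).
  apply pos_sup_ub; auto; intros n; rewrite !real_coord_plus.
  generalize (Hz n) (Hw n); lra.
Qed.

Lemma pos_sup_scal_le (t : R) a : 0 < t -> nonneg a ->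
  pos_sup (scal t a) <= t * pos_sup a.
Proof.
intros Ht Ha; apply pos_sup_le.
- intros n; rewrite real_coord_scal; generalize (Ha n); nra.
- intros z Hz.
  replace z with (scal t (scal (/ t) z) : V).
  2: { apply real_ext; intros n; rewrite !real_coord_scal; field; lra. }
  rewrite L_scal; apply Rmult_le_compat_l; [lra |].
  apply pos_sup_ub; auto; intros n; rewrite real_coord_scal.
  specialize (Hz n); rewrite real_coord_scal in Hz.
  assert (Hi := Rinv_0_lt_compat t Ht); split; [nra |].
  apply Rmult_le_reg_l with t; [exact Ht |].
  rewrite <- Rmult_assoc, Rinv_r; lra.
Qed.

(** For [t > 0] the missing inequality is the previous one for the factor [/ t] and the sequence
    [scal t a]. *)
Lemma pos_sup_scal (t : R) a : 0 <= t -> nonneg a ->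
  pos_sup (scal t a) = t * pos_sup a.
Proof.
intros [Ht | <-] Ha.
- apply Rle_antisym; [now apply pos_sup_scal_le |].
  assert (Hi := Rinv_0_lt_compat t Ht).
  assert (H : pos_sup (scal (/ t) (scal t a)) <= / t * pos_sup (scal t a)).
  { apply pos_sup_scal_le; auto; intros n; rewrite real_coord_scal.
    generalize (Ha n); nra. }
  replace (scal (/ t) (scal t a) : V) with a in H.
  2: { apply real_ext; intros n; rewrite !real_coord_scal; field; lra. }
  apply Rmult_le_reg_l with (/ t); [exact Hi |].
  rewrite <- Rmult_assoc, Rinv_l; lra.
- replace (scal 0 a : V) with (zero : V); [rewrite pos_sup_zero; ring |].
  symmetry; exact (scal_zero_l a).
Qed.

Definition seq_pos a : V := seq_max a zero.
Definition seq_neg a : V := seq_max (opp a) zero.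

(** The linear extension of [pos_sup] from the cone of nonnegative sequences to the whole space. *)
Definition pos_part a : R := pos_sup (seq_pos a) - pos_sup (seq_neg a).

Lemma seq_pos_coord a n : rcoord (seq_pos a) n = Rmax (rcoord a n) 0.
Proof. reflexivity. Qed.

Lemma seq_neg_coord a n : rcoord (seq_neg a) n = Rmax (- rcoord a n) 0.
Proof. reflexivity. Qed.

Lemma seq_pos_nonneg a : nonneg (seq_pos a).
Proof. intros n; apply Rmax_r. Qed.

Lemma seq_neg_nonneg a : nonneg (seq_neg a).
Proof. intros n; apply Rmax_r. Qed.

Lemma seq_pos_neg a n : rcoord (seq_pos a) n - rcoord (seq_neg a) n = rcoord a n.
Proof.
rewrite seq_pos_coord, seq_neg_coord; unfold Rmax; repeat destruct Rle_dec; lra.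
Qed.

(** The value is independent of how a sequence is written as a difference of nonnegative ones: with
    [a = b - c], the sums of [seq_pos a] and [c] and of [seq_neg a] and [b] agree, and [pos_sup] is
    additive. Linearity follows by picking convenient differences. *)
Lemma pos_part_minus b c : nonneg b -> nonneg c ->
  pos_part (minus b c) = pos_sup b - pos_sup c.
Proof.
intros Hb Hc; unfold pos_part.
assert (E : plus (seq_pos (minus b c)) c = plus (seq_neg (minus b c)) b).
{ apply real_ext; intros n; rewrite !real_coord_plus.
  generalize (seq_pos_neg (minus b c) n); rewrite real_coord_minus; lra. }
apply (f_equal pos_sup) in E.
rewrite !pos_sup_plus in E by auto using seq_pos_nonneg, seq_neg_nonneg; lra.
Qed.

Lemma pos_part_nonneg a : nonneg a -> pos_part a = pos_sup a.
Proof.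
intros Ha.
assert (E := pos_part_minus a zero Ha (fun n => Rle_refl 0)).
rewrite pos_sup_zero, Rminus_0_r in E; rewrite <- E; f_equal.
apply real_ext; intros n; rewrite real_coord_minus, coord_zero; lra.
Qed.

Lemma pos_part_plus a b : pos_part (plus a b) = pos_part a + pos_part b.
Proof.
replace (plus a b) with
  (minus (plus (seq_pos a) (seq_pos b)) (plus (seq_neg a) (seq_neg b)) : V).
- assert (H := seq_pos_nonneg); assert (H' := seq_neg_nonneg).
  rewrite pos_part_minus, !pos_sup_plus; auto; [unfold pos_part; ring | |];
    intros n; rewrite real_coord_plus; auto using Rplus_le_le_0_compat.
- apply real_ext; intros n; rewrite real_coord_minus, !real_coord_plus.
  generalize (seq_pos_neg a n) (seq_pos_neg b n); lra.
Qed.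

Lemma pos_part_scal (t : R) a : pos_part (scal t a) = t * pos_part a.
Proof.
assert (H := seq_pos_nonneg a); assert (H' := seq_neg_nonneg a).
destruct (Rle_dec 0 t) as [Ht | Ht].
- replace (scal t a) with
    (minus (scal t (seq_pos a)) (scal t (seq_neg a)) : V).
  + rewrite pos_part_minus, !pos_sup_scal; auto; [unfold pos_part; ring | |];
      intros n; rewrite real_coord_scal; auto using Rmult_le_pos.
  + apply real_ext; intros n; rewrite real_coord_minus, !real_coord_scal.
    rewrite <- (seq_pos_neg a n); ring.
(* A negative factor exchanges the positive and negative parts. *)
- assert (Ht' : 0 <= - t) by lra.
  replace (scal t a) with
    (minus (scal (- t) (seq_neg a)) (scal (- t) (seq_pos a)) : V).
  + rewrite pos_part_minus, !pos_sup_scal; auto; [unfold pos_part; ring | |];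
      intros n; rewrite real_coord_scal; auto using Rmult_le_pos.
  + apply real_ext; intros n; rewrite real_coord_minus, !real_coord_scal.
    rewrite <- (seq_pos_neg a n); ring.
Qed.

(** Both [P] and [P - L] are positive, so their sizes are governed by their values at [linf_one].
    The last bound holds because sequences with values in [0, 1] have norm at most 1. *)
Lemma positive_part_exists :
  exists P : V -> R,
    (forall a b, P (plus a b) = P a + P b) /\
    (forall (t : R) a, P (scal t a) = t * P a) /\
    (forall a, nonneg a -> 0 <= P a /\ L a <= P a) /\
    P linf_one <= 1.
Proof.
exists pos_part; repeat split.
- apply pos_part_plus.
- apply pos_part_scal.
- rewrite pos_part_nonneg by auto; now apply pos_sup_ge.
- rewrite pos_part_nonneg by auto; now apply pos_sup_ge.
- assert (H : nonneg (linf_one : V)) by (intros n; rewrite coord_one; lra).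
  rewrite pos_part_nonneg by auto; apply pos_sup_le; auto.
  intros z Hz; apply Rle_trans with (1 := L_between0 _ z Hz).
  apply (linf_norm_le R_AbsRing); intros n; apply Req_le; exact Rabs_R1.
Qed.

End PositivePart.

(** The sequences [norm a * 1 + a] and [norm a * 1 - a] are both nonnegative, so [P] is nonnegative
    at each of them. *)
Lemma positive_functional_bound (P : linf_NormedModule R_AbsRing -> R) a :
  (forall a b, P (plus a b) = P a + P b) ->
  (forall (t : R) a, P (scal t a) = t * P a) ->
  (forall a, (forall n, 0 <= rcoord a n) -> 0 <= P a) ->
  Rabs (P a) <= P linf_one * norm a.
Proof.
intros Hp Hs H0.
assert (H : forall s : R, Rabs s = 1 -> 0 <= P linf_one * norm a + s * P a).
{ intros s Hsgn; rewrite Rmult_comm, <- !Hs, <- Hp; apply H0; intros n.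
  rewrite real_coord_plus, !real_coord_scal, coord_one.
  assert (Hn := coord_le_norm R_AbsRing a n).
  change (Rabs (rcoord a n) <= norm a) in Hn.
  assert (Hm : Rabs (s * rcoord a n) <= norm a) by (rewrite Rabs_mult, Hsgn; lra).
  apply Rabs_le_between in Hm; lra. }
apply Rabs_le_between.
assert (H1 := H 1 Rabs_R1).
assert (H2 := H (-1) ltac:(rewrite Rabs_left; lra)); lra.
Qed.

(** * Approximation by a positive functional *)

Section Approximation.
Context {k : scalars}.
Notation K := (scalar_field k).
Notation VR := (linf_NormedModule R_AbsRing).
Notation VK := (linf_NormedModule K).

Lemma re_of_R_mult x (z : K) : re (mult (of_R x) z) = x * re z.
Proof. rewrite re_mul, re_of_R, im_of_R; ring. Qed.

Lemma im_of_R_mult x (z : K) : im (mult (of_R x) z) = x * im z.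
Proof. rewrite im_mul, re_of_R, im_of_R; ring. Qed.

Definition seq_re (y : VK) : VR.
Proof.
exists (fun n => re (coord y n)); exists (linf_norm y); intros n.
apply Rle_trans with (1 := abs_re _); exact (coord_le_norm K y n).
Defined.

Definition seq_im (y : VK) : VR.
Proof.
exists (fun n => im (coord y n)); exists (linf_norm y); intros n.
apply Rle_trans with (1 := abs_im _); exact (coord_le_norm K y n).
Defined.

Definition seq_of_R (a : VR) : VK.
Proof.
exists (fun n => of_R (rcoord a n)); exists (linf_norm a); intros n.
rewrite abs_of_R; exact (coord_le_norm R_AbsRing a n).
Defined.

Lemma seq_of_R_plus a b : seq_of_R (plus a b) = plus (seq_of_R a) (seq_of_R b).
Proof. apply linf_ext; intros n; apply of_R_plus. Qed.

Lemma seq_of_R_scal (t : R) a : seq_of_R (scal t a) = scal (of_R t) (seq_of_R a).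
Proof. apply linf_ext; intros n; apply of_R_mult. Qed.

Lemma norm_seq_of_R a : norm (seq_of_R a) <= norm a.
Proof.
apply (linf_norm_le K); intros n.
change (abs (of_R (k:=k) (rcoord a n)) <= norm a).
rewrite abs_of_R; exact (coord_le_norm R_AbsRing a n).
Qed.

Lemma norm_seq_re y : norm (seq_re y) <= norm y.
Proof.
apply (linf_norm_le R_AbsRing); intros n.
apply Rle_trans with (1 := abs_re _); exact (coord_le_norm K y n).
Qed.

Lemma norm_seq_im y : norm (seq_im y) <= norm y.
Proof.
apply (linf_norm_le R_AbsRing); intros n.
apply Rle_trans with (1 := abs_im _); exact (coord_le_norm K y n).
Qed.

Lemma seq_decomp y :
  y = plus (seq_of_R (seq_re y)) (scal imag_unit (seq_of_R (seq_im y))).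
Proof. apply linf_ext; intros n; apply scalar_decomp. Qed.

(* Testing [phi] on [1 + i s a] with [s] real: its real part is
   [re (phi 1) - s im (phi a)], whereas the norm of [1 + i s a] is
   [1 + O(s^2)]. *)
Lemma im_functional_small (phi : VK -> AbsRing_NormedModule K) (t : R) (a : VR) :
  is_linear phi -> (forall y, norm (phi y) <= norm y) ->
  0 < t -> 1 - t * t <= re (phi linf_one) ->
  Rabs (im (phi (seq_of_R a))) <= 3 / 2 * t * norm a.
Proof.
intros Hphi Hb Ht H1.
set (w := phi (seq_of_R a)).
assert (Hw : Rabs (im w) <= norm a).
{ apply Rle_trans with (1 := abs_im w).
  apply Rle_trans with (1 := Hb _), norm_seq_of_R. }
destruct (Req_dec (norm a) 0) as [E | E]; [rewrite E in *; lra |].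
assert (Ha : 0 < norm a) by (generalize (norm_ge_0 a); lra).
assert (H : forall s : R, Rabs s = 1 -> - (s * im w) <= 3 / 2 * t * norm a).
{ intros s Hs.
  (* This scale makes every [r * rcoord a n] at most [t] in absolute value. The deficit [t * t] at
     [linf_one] and the norm excess [t * t / 2] then balance: their sum, divided by [t / norm a], is
     the claimed bound. *)
  set (r := s * t / norm a).
  set (z := plus linf_one (scal imag_unit (seq_of_R (scal (r : R) a))) : VK).
  assert (Hz : norm z <= 1 + t * t / 2).
  { apply (linf_norm_le K); intros n.
    apply Rle_trans with (1 := abs_one_plus_imag (r * rcoord a n)).
    enough (Hr : Rabs (r * rcoord a n) <= t).
    { apply Rabs_le_between in Hr; nra. }
    assert (Hn : Rabs (rcoord a n) <= norm a) by exact (coord_le_norm R_AbsRing a n).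
    unfold r, Rdiv; rewrite !Rabs_mult, Hs, Rabs_inv, (Rabs_pos_eq t),
      (Rabs_pos_eq (norm a)) by lra.
    apply Rmult_le_reg_r with (norm a); [exact Ha |].
    replace (1 * t * / norm a * Rabs (rcoord a n) * norm a)
      with (t * Rabs (rcoord a n)) by (field; lra).
    apply Rmult_le_compat_l; lra. }
  assert (Hre : re (phi z) = re (phi linf_one) - r * im w).
  { unfold z; rewrite (linear_plus phi Hphi), (linear_scal phi Hphi),
      seq_of_R_scal, (linear_scal phi Hphi).
    fold w; change (re (plus (phi linf_one : K) (mult imag_unit (mult (of_R r) w)))
      = re (phi linf_one) - r * im w).
    rewrite re_add, re_imag_mult, im_of_R_mult; ring. }
  assert (Hle : re (phi z) <= 1 + t * t / 2).
  { apply Rle_trans with (1 := Rle_abs _), Rle_trans with (1 := abs_re _).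
    apply Rle_trans with (1 := Hb z), Hz. }
  assert (Hr : - (r * im w) <= 3 / 2 * (t * t)) by lra.
  apply Rmult_le_reg_l with (t / norm a);
    [now apply Rdiv_lt_0_compat |].
  replace (t / norm a * - (s * im w)) with (- (r * im w)) by (unfold r; field; lra).
  replace (t / norm a * (3 / 2 * t * norm a)) with (3 / 2 * (t * t)) by (field; lra).
  exact Hr. }
apply Rabs_le_between.
assert (Hp := H 1 Rabs_R1).
assert (Hm := H (-1) ltac:(rewrite Rabs_left; lra)); lra.
Qed.

Section Complexification.
Variable q : VR -> R.
Hypothesis q_plus : forall a b, q (plus a b) = q a + q b.
Hypothesis q_scal : forall (t : R) a, q (scal t a) = t * q a.
Hypothesis q_one : q linf_one = 1.
Hypothesis q_pos : forall a, (forall n, 0 <= rcoord a n) -> 0 <= q a.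

(** The complexification of [q]; over the reals the second term vanishes and [q] itself remains. *)
Definition extend_functional (y : VK) : AbsRing_NormedModule K :=
  plus (of_R (q (seq_re y)) : K) (mult imag_unit (of_R (q (seq_im y)))).

Lemma extend_functional_plus x y :
  extend_functional (plus x y) = plus (extend_functional x) (extend_functional y).
Proof.
unfold extend_functional.
replace (seq_re (plus x y)) with (plus (seq_re x) (seq_re y)).
2: { apply real_ext; intros n; symmetry; apply re_add. }
replace (seq_im (plus x y)) with (plus (seq_im x) (seq_im y)).
2: { apply real_ext; intros n; symmetry; apply im_add. }
rewrite !q_plus, !of_R_plus.
rewrite (mult_distr_l (K:=K)).
rewrite <- !plus_assoc; f_equal; rewrite !plus_assoc; f_equal; apply plus_comm.
Qed.

Lemma extend_functional_scal (c : K) y :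
  extend_functional (scal c y) = mult c (extend_functional y).
Proof.
unfold extend_functional.
replace (seq_re (scal c y)) with
  (minus (scal (re c) (seq_re y)) (scal (im c) (seq_im y)) : VR).
2: { apply real_ext; intros n; symmetry; apply re_mul. }
replace (seq_im (scal c y)) with
  (plus (scal (re c) (seq_im y)) (scal (im c) (seq_re y)) : VR).
2: { apply real_ext; intros n; symmetry; apply im_mul. }
assert (Hm : forall a b, q (minus a b) = q a - q b).
{ intros a b; unfold minus; rewrite q_plus.
  replace (opp b) with (scal (-1) b : VR) by
    (apply real_ext; intros n; rewrite real_coord_scal;
     change (-1 * rcoord b n = - rcoord b n); ring).
  rewrite q_scal; ring. }
rewrite Hm, q_plus, !q_scal; apply mult_decomp.
Qed.

Lemma re_extend_functional y : re (extend_functional y) = q (seq_re y).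
Proof.
unfold extend_functional; rewrite re_add, re_of_R, re_imag_mult, im_of_R; ring.
Qed.

(** Rotating [y] makes the value real and nonnegative, hence equal to [q] of a real part, where
    positivity and [q 1 = 1] give the bound. Estimating the two parts separately would cost a
    constant factor. *)
Lemma extend_functional_bound y : abs (extend_functional y) <= norm y.
Proof.
destruct (scalar_phase (extend_functional y)) as [c [Hc E]].
rewrite <- (re_of_R (k:=k) (abs (extend_functional y))), <- E,
  <- extend_functional_scal, re_extend_functional.
apply Rle_trans with (1 := Rle_abs _).
apply Rle_trans with (1 := positive_functional_bound q _ q_plus q_scal q_pos).
rewrite q_one, Rmult_1_l; apply Rle_trans with (1 := norm_seq_re _).
apply Rle_trans with (1 := norm_scal _ _); rewrite Hc; lra.
Qed.

Lemma extend_functional_linear : is_linear extend_functional.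
Proof.
split.
- exact extend_functional_plus.
- exact extend_functional_scal.
- exists 1; split; [lra |]; intros y; rewrite Rmult_1_l.
  apply extend_functional_bound.
Qed.

Lemma extend_functional_one : extend_functional linf_one = one.
Proof.
unfold extend_functional.
replace (seq_re linf_one) with (linf_one : VR).
2: { apply real_ext; intros n; change (1 = re (k:=k) one).
     now rewrite <- of_R_1, re_of_R. }
replace (seq_im linf_one) with (zero : VR).
2: { apply real_ext; intros n; change (0 = im (k:=k) one).
     now rewrite <- of_R_1, im_of_R. }
assert (q0 : q zero = 0).
{ replace (zero : VR) with (scal 0 zero : VR) by exact (scal_zero_l _).
  rewrite q_scal; ring. }
rewrite q_one, q0, of_R_1.
replace (of_R (k:=k) 0) with (zero : K) by (destruct k; reflexivity).
rewrite (mult_zero_r (K:=K)); apply plus_zero_r.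
Qed.

End Complexification.

(** Here [psi] is the complexification of the positive part of [re phi], normalized at [linf_one].
    On real sequences the real parts differ by at most [2 * t * t], hence [2 * t], and the imaginary
    part of [phi] adds [3 / 2 * t]. Splitting a sequence into real and imaginary parts doubles the
    sum [7 / 2 * t]. *)
Lemma positive_approximation (phi : VK -> AbsRing_NormedModule K) (t : R) :
  is_linear phi -> (forall y, norm (phi y) <= norm y) ->
  0 < t < 1 -> 1 - t * t <= re (phi linf_one) ->
  exists psi : VK -> AbsRing_NormedModule K,
    is_linear psi /\ (forall y, norm (psi y) <= norm y) /\ psi linf_one = one /\
    forall y, norm (minus (phi y) (psi y)) <= 7 * t * norm y.
Proof.
intros Hphi Hb Ht H1.
set (L := fun a : VR => re (phi (seq_of_R a))).
assert (L_plus : forall a b, L (plus a b) = L a + L b).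
{ intros a b; unfold L; rewrite seq_of_R_plus, (linear_plus phi Hphi); apply re_add. }
assert (L_scal : forall (r : R) a, L (scal r a) = r * L a).
{ intros r a; unfold L; rewrite seq_of_R_scal, (linear_scal phi Hphi).
  apply re_of_R_mult. }
assert (L_bound : forall a, Rabs (L a) <= norm a).
{ intros a; apply Rle_trans with (1 := abs_re _), Rle_trans with (1 := Hb _).
  apply norm_seq_of_R. }
destruct (positive_part_exists L L_plus L_scal L_bound)
  as [P [P_plus [P_scal [P_pos P_one]]]].
assert (L_one : 1 - t * t <= L linf_one).
{ unfold L; replace (seq_of_R linf_one) with (linf_one : VK); [exact H1 |].
  apply linf_ext; intros n; symmetry; apply of_R_1. }
set (m := P linf_one) in *.
assert (Hm : 1 - t * t <= m).
{ apply Rle_trans with (1 := L_one), P_pos; intros n; rewrite coord_one; lra. }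
assert (Hm0 : 0 < m) by nra.
set (q := fun a : VR => P a / m).
assert (q_plus : forall a b, q (plus a b) = q a + q b).
{ intros a b; unfold q; rewrite P_plus; field; lra. }
assert (q_scal : forall (r : R) a, q (scal r a) = r * q a).
{ intros r a; unfold q; rewrite P_scal; field; lra. }
assert (q_one : q linf_one = 1) by (unfold q; fold m; field; lra).
assert (q_pos : forall a, (forall n, 0 <= rcoord a n) -> 0 <= q a).
{ intros a Ha; apply Rmult_le_pos; [now apply P_pos |].
  now apply Rlt_le, Rinv_0_lt_compat. }
assert (q_close : forall a, Rabs (L a - q a) <= 2 * (t * t) * norm a).
{ intros a.
  (* Since [P - L] is positive, closeness at the single sequence [linf_one] gives closeness in norm.
     Normalizing [P] by [m] costs a further [1 - m], also at most [t * t]. *)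
  assert (H2 : Rabs (P a - L a) <= (m - L linf_one) * norm a).
  { apply (positive_functional_bound (fun a => P a - L a)).
    - intros b c; rewrite P_plus, L_plus; ring.
    - intros r b; rewrite P_scal, L_scal; ring.
    - intros b Hbp; generalize (proj2 (P_pos b Hbp)); lra. }
  assert (H3 := positive_functional_bound q a q_plus q_scal q_pos).
  rewrite q_one, Rmult_1_l in H3.
  assert (H4 : P a = m * q a) by (unfold q; field; lra).
  assert (H5 : L a - q a = - (P a - L a) + - ((1 - m) * q a)) by (rewrite H4; ring).
  rewrite H5; apply Rle_trans with (1 := Rabs_triang _ _).
  rewrite !Rabs_Ropp, Rabs_mult, (Rabs_pos_eq (1 - m)) by lra.
  assert (H6 := norm_ge_0 a).
  assert (H7 : (1 - m) * Rabs (q a) <= t * t * norm a).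
  { apply Rmult_le_compat; try lra; apply Rabs_pos. }
  assert (H8 : (m - L linf_one) * norm a <= t * t * norm a).
  { apply Rmult_le_compat_r; lra. }
  lra. }
exists (extend_functional q).
split; [now apply extend_functional_linear |].
split; [now apply extend_functional_bound |].
split; [now apply extend_functional_one |].
intros y.
assert (Hc : forall a, abs (minus (phi (seq_of_R a) : K) (of_R (q a)))
    <= 7 / 2 * t * norm a).
{ intros a.
  assert (Hi := im_functional_small phi t a Hphi Hb (proj1 Ht) H1).
  rewrite (scalar_decomp (phi (seq_of_R a))); fold (L a).
  set (i := mult _ _).
  replace (minus (plus (of_R (L a)) i) (of_R (q a)))
    with (plus (of_R (L a - q a)) i).
  2: { rewrite of_R_minus; unfold minus; rewrite <- !plus_assoc; f_equal.
       apply plus_comm. }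
  apply Rle_trans with (1 := abs_triangle _ _).
  unfold i; rewrite abs_mult_eq, !abs_of_R.
  assert (Hu := abs_imag_unit (k := k)).
  assert (Hv := Rabs_pos (im (phi (seq_of_R a)))).
  assert (Hq := q_close a).
  assert (Hn := norm_ge_0 a).
  assert (t * t * norm a <= t * norm a) by nra.
  nra. }
assert (E : minus (phi y) (extend_functional q y) =
  plus (minus (phi (seq_of_R (seq_re y)) : K) (of_R (q (seq_re y))) : K)
    (mult imag_unit
       (minus (phi (seq_of_R (seq_im y)) : K) (of_R (q (seq_im y)))))).
{ rewrite (seq_decomp y) at 1.
  rewrite (linear_plus phi Hphi), (linear_scal phi Hphi).
  unfold extend_functional, minus.
  rewrite (mult_distr_l (K:=K)), (opp_plus (G:=K)), (opp_mult_r (K:=K)).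
  change (scal (V := AbsRing_NormedModule K)) with (mult (K:=K)).
  generalize (phi (seq_of_R (seq_re y)) : K) (mult imag_unit (phi (seq_of_R (seq_im y))) : K).
  intros A B.
  rewrite <- !(plus_assoc (G:=K)); f_equal.
  rewrite !(plus_assoc (G:=K)); f_equal; apply plus_comm. }
rewrite E.
apply Rle_trans with (1 := abs_triangle _ _); rewrite abs_mult_eq.
assert (Hu := abs_imag_unit (k := k)).
assert (H2 := Hc (seq_re y)); assert (H3 := Hc (seq_im y)).
assert (H4 := norm_seq_re y); assert (H5 := norm_seq_im y).
assert (H6 : t * norm (seq_re y) <= t * norm y) by (apply Rmult_le_compat_l; lra).
assert (H7 : t * norm (seq_im y) <= t * norm y) by (apply Rmult_le_compat_l; lra).
assert (H8 := Rmult_le_compat_r _ _ _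
  (abs_ge_0 (minus (phi (seq_of_R (seq_im y)) : K) (of_R (q (seq_im y))))) Hu).
rewrite Rmult_1_l in H8.
eapply Rle_trans; [apply Rplus_le_compat; [exact H2 | exact (Rle_trans _ _ _ H8 H3)] |].
lra.
Qed.

End Approximation.

(** * Correcting functionals and operators *)

Section LinearMaps.
Context {k : scalars} {U V : NormedModule (scalar_field k)}.
Notation K := (scalar_field k).

Lemma is_linear_op_sub (S T : U -> V) :
  is_linear S -> is_linear T -> is_linear (op_sub S T).
Proof.
intros HS HT; apply (is_linear_ext (fun x => plus (S x) (opp (T x)))); [reflexivity |].
apply (is_linear_comp (fun x => (S x, opp (T x))) (fun p => plus (fst p) (snd p))).
- apply is_linear_prod; [exact HS |].
  exact (is_linear_comp T opp HT is_linear_opp).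
- apply is_linear_plus.
Qed.

Lemma is_linear_mult (c : K) (f : U -> AbsRing_NormedModule K) :
  is_linear f -> is_linear (fun x => mult c (f x) : AbsRing_NormedModule K).
Proof.
intros Hf; apply (is_linear_comp f (fun z => scal c z) Hf).
apply is_linear_scal_r; exact mult_scalar_comm.
Qed.

Lemma contraction_is_linear (T : U -> V) :
  (forall x y, T (plus x y) = plus (T x) (T y)) ->
  (forall (c : K) x, T (scal c x) = scal c (T x)) ->
  (forall x, norm (T x) <= norm x) -> is_linear T.
Proof.
intros Hp Hs Hn; split; auto.
exists 1; split; [lra |]; intros x; rewrite Rmult_1_l; apply Hn.
Qed.

End LinearMaps.

Section WeightedComposition.
Context {k : scalars}.
Notation K := (scalar_field k).
Notation VK := (linf_NormedModule K).
Variables (m : nat -> K) (r : nat -> nat).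
Hypothesis m_le : forall n, abs (m n) <= 1.

Lemma weighted_le (y : VK) n : abs (mult (m n) (coord y (r n))) <= norm y.
Proof.
rewrite abs_mult_eq.
assert (H := coord_le_norm K y (r n)); change (linf_norm y) with (norm y) in H.
generalize (m_le n) (abs_ge_0 (m n)) (abs_ge_0 (coord y (r n))); nra.
Qed.

(** Two instances are used: multiplication by a sequence of the unit ball, with [r] the identity,
    and multiplication by phases followed by composition with a retraction of the index set. *)
Definition weighted_comp (y : VK) : VK :=
  exist _ (fun n => mult (m n) (coord y (r n)))
    (ex_intro _ (norm y) (weighted_le y)).

Lemma weighted_comp_norm y : norm (weighted_comp y) <= norm y.
Proof. apply (linf_norm_le K); exact (weighted_le y). Qed.

Lemma weighted_comp_linear : is_linear weighted_comp.
Proof.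
apply contraction_is_linear.
- intros x y; apply linf_ext; intros n; exact (mult_distr_l (K := K) _ _ _).
- intros c x; apply linf_ext; intros n.
  change (mult (m n) (mult c (coord x (r n))) = mult c (mult (m n) (coord x (r n)))).
  rewrite !(mult_assoc (K := K)); f_equal; apply mult_scalar_comm.
- apply weighted_comp_norm.
Qed.

End WeightedComposition.

Section Functionals.
Context {k : scalars}.
Notation K := (scalar_field k).
Notation VK := (linf_NormedModule K).
Variable g : VK -> AbsRing_NormedModule K.
Hypothesis g_lin : is_linear g.
Hypothesis g_le : forall y, norm (g y) <= norm y.

Lemma re_functional_le y : re (g y) <= norm y.
Proof.
apply Rle_trans with (1 := Rle_abs _), Rle_trans with (1 := abs_re _), g_le.
Qed.

(** Disjoint supports allow adding to [w] a normalized multiple of [y] without leaving the unit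
    ball. With the phase chosen so that the contribution of [y] is nonnegative, it has only the gap
    [d] below 1 left to fill. *)
Lemma functional_small_off_support (w y : VK) (d : R) :
  norm w <= 1 -> 1 - d <= re (g w) ->
  (forall n, coord w n = zero \/ coord y n = zero) ->
  norm (g y) <= d * norm y.
Proof.
intros Hw Hd Hdis.
destruct (Req_dec (norm y) 0) as [E | E].
{ generalize (g_le y); rewrite E; lra. }
assert (Hy : 0 < norm y) by (generalize (norm_ge_0 y); lra).
destruct (scalar_phase (g y)) as [c [Hc Ec]].
set (s := / norm y).
assert (Hs : 0 < s) by now apply Rinv_0_lt_compat.
assert (Hz : norm (plus w (scal (mult (of_R s) c) y)) <= 1).
{ apply (linf_norm_le K); intros n; rewrite coord_plus, coord_scal.
  destruct (Hdis n) as [-> | ->].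
  - rewrite (plus_zero_l (G := K)), !abs_mult_eq, Hc, abs_of_R, Rabs_pos_eq by lra.
    rewrite Rmult_1_r, <- (Rinv_l (norm y)) by exact E.
    fold s; apply Rmult_le_compat_l; [lra | exact (coord_le_norm K y n)].
  - rewrite (mult_zero_r (K := K)), (plus_zero_r (G := K)).
    apply Rle_trans with (2 := Hw); exact (coord_le_norm K w n). }
assert (H := Rle_trans _ _ _ (re_functional_le _) Hz).
rewrite (linear_plus g g_lin), (linear_scal g g_lin) in H.
change (re (plus (g w : K) (mult (mult (of_R s) c) (g y))) <= 1) in H.
rewrite re_add, <- mult_assoc, Ec, <- of_R_mult, re_of_R in H.
change (abs (g y : K)) with (norm (g y)) in H.
apply Rmult_le_reg_l with s; [exact Hs |].
replace (s * (d * norm y)) with d by (unfold s; field; lra).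
lra.
Qed.

(* Stretching [v] by [1 / (1 - b)] at the coordinates where [|v n| <= 1 - b]
   keeps it in the unit ball, so these coordinates contribute little to [g v]. *)
Lemma functional_large_coordinates (v w : VK) (b : R) :
  0 < b < 1 -> norm v <= 1 -> 1 - b * b <= re (g v) ->
  (forall n, coord w n = coord v n \/
     (coord w n = zero /\ abs (coord v n) <= 1 - b)) ->
  1 - b <= re (g w).
Proof.
intros Hb Hv Hg Hw.
set (s := b / (1 - b)).
assert (Hs : 0 < s) by (apply Rdiv_lt_0_compat; lra).
assert (Hz : norm (plus v (scal (of_R s) (minus v w))) <= 1).
{ apply (linf_norm_le K); intros n; rewrite coord_plus, coord_scal, coord_minus.
  destruct (Hw n) as [-> | [-> Hn]].
  - rewrite (minus_eq_zero (G := K)), (mult_zero_r (K := K)), (plus_zero_r (G := K)).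
    apply Rle_trans with (2 := Hv); exact (coord_le_norm K v n).
  - rewrite (minus_zero_r (G := K)); apply Rle_trans with (1 := abs_triangle _ _).
    rewrite abs_mult_eq, abs_of_R, Rabs_pos_eq by lra.
    replace 1 with ((1 - b) + s * (1 - b)) by (unfold s; field; lra).
    apply Rplus_le_compat; [exact Hn |]; apply Rmult_le_compat_l; lra. }
assert (H := Rle_trans _ _ _ (re_functional_le _) Hz).
rewrite (linear_plus g g_lin), (linear_scal g g_lin), (linear_minus g _ _ g_lin) in H.
change (re (plus (g v : K) (mult (of_R s) (plus (g v : K) (opp (g w : K))))) <= 1) in H.
rewrite re_add, re_of_R_mult, re_add, re_neg in H.
assert (Hs' : s * (1 - b) = b) by (unfold s; field; lra).
assert (H' : s * (re (g v) - re (g w)) <= b * b) by lra.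
(* The deficit [b * b] is tuned to this division by [s]: [1 - b * b - b * (1 - b)] is exactly
   [1 - b]. *)
assert (H'' : re (g v) - re (g w) <= b * (1 - b)).
{ apply Rmult_le_reg_l with s; [exact Hs |].
  replace (s * (b * (1 - b))) with (b * (s * (1 - b))) by ring.
  rewrite Hs'; exact H'. }
nra.
Qed.

(* With a retraction [r] of [nat] onto [A], pulling the positive functional [psi]
   back along [y |-> (c y) o r] makes only the coordinates in [A] matter. *)
Lemma norming_functional_near (A : nat -> bool) (c c' : nat -> K) (w : VK) (t : R) :
  (forall n, abs (c n) = 1) -> (forall n, abs (c' n) = 1) ->
  (forall n, mult (c' n) (c n) = one) ->
  (forall n, coord w n = if A n then c' n else zero) ->
  0 < t < 1 -> 1 - t * t <= re (g w) ->
  exists g1 : VK -> AbsRing_NormedModule K,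
    is_linear g1 /\ (forall y, norm (g1 y) <= norm y) /\
    (forall y, (forall n, A n = true -> mult (c n) (coord y n) = one) -> g1 y = one) /\
    forall y, norm (minus (g1 y) (g y)) <= 8 * t * norm y.
Proof.
intros Hc Hc' Hcc Hw Ht Hg.
assert (Hw1 : forall n, abs (coord w n) <= 1).
{ intros n; rewrite Hw; destruct (A n); [rewrite Hc' | rewrite abs_zero]; lra. }
(* A retraction onto [A] requires a point of [A]; if there were none, [w] would vanish, against the
   lower bound on [re (g w)]. *)
assert (HA : exists n0, A n0 = true).
{ apply NNPP; intros HA.
  assert (E : w = zero).
  { apply linf_ext; intros n; rewrite Hw.
    destruct (A n) eqn:En; [exfalso; eauto | reflexivity]. }
  assert (H0 := re_functional_le w).
  rewrite E, norm_zero, <- E in H0; nra. }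
destruct HA as [n0 Hn0].
set (r := fun n => if A n then n else n0).
assert (Hr : forall n, A (r n) = true) by (intros n; unfold r; destruct (A n) eqn:E; auto).
assert (HwK : norm w <= 1) by now apply (linf_norm_le K).
set (M := weighted_comp (coord w) (fun n => n) Hw1).
assert (Hcr : forall n, abs (c (r n)) <= 1) by (intros n; rewrite Hc; lra).
set (N := weighted_comp (fun n => c (r n)) r Hcr).
(* Multiplication by [w] sends [linf_one] to [w], so the hypothesis on [g w] says that [g] composed
   with [M] is nearly 1 at [linf_one]. *)
destruct (positive_approximation (fun y => g (M y)) t) as [psi [P1 [P2 [P3 P4]]]].
- exact (is_linear_comp M g (weighted_comp_linear _ _ _) g_lin).
- intros y; apply Rle_trans with (1 := g_le _), weighted_comp_norm.
- exact Ht.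
- replace (M linf_one) with w; [exact Hg |].
  apply linf_ext; intros n; symmetry; exact (mult_one_r (coord w n)).
- exists (fun y => psi (N y)); split; [| split; [| split]].
  + exact (is_linear_comp N psi (weighted_comp_linear _ _ _) P1).
  + intros y; apply Rle_trans with (1 := P2 _), weighted_comp_norm.
  (* As [r] takes values in [A] only, the hypothesis on [y] makes [N y] the constant sequence 1. *)
  + intros y Hy; rewrite <- P3; f_equal.
    apply linf_ext; intros n; exact (Hy (r n) (Hr n)).
  + intros y.
    assert (HN : norm (N y) <= norm y) by apply weighted_comp_norm.
    assert (H1 := P4 (N y)).
    (* On [A] the phases cancel and [M (N y)] is [y]; off [A] it is zero. So [d] is [y] cut to the
       complement of [A], disjoint from [w], and adds at most [t * t] to the error [7 * t]. *)
    set (d := minus y (M (N y))).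
    assert (Hd : forall n, coord d n = if A n then zero else coord y n).
    { intros n; unfold d; rewrite coord_minus.
      change (minus (coord y n)
        (mult (coord w n) (mult (c (r n)) (coord y (r n)))) =
        if A n then zero else coord y n).
      rewrite Hw; unfold r; destruct (A n).
      - rewrite mult_assoc, Hcc, mult_one_l; apply (minus_eq_zero (G := K)).
      - rewrite (mult_zero_l (K := K)); apply (minus_zero_r (G := K)). }
    assert (Hdy : norm d <= norm y).
    { apply (linf_norm_le K); intros n; rewrite Hd.
      destruct (A n); [rewrite abs_zero; apply norm_ge_0 |].
      exact (coord_le_norm K y n). }
    assert (H2 : norm (g d) <= t * t * norm d).
    { apply (functional_small_off_support w); auto.
      intros n; rewrite Hw, Hd; destruct (A n); auto. }
    assert (E : minus (psi (N y)) (g y) =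
      opp (plus (minus (g (M (N y))) (psi (N y))) (g d))).
    { unfold d; rewrite (linear_minus g _ _ g_lin).
      rewrite <- (opp_minus (g y) (psi (N y))); f_equal.
      rewrite (minus_trans (g (M (N y)))), plus_comm; reflexivity. }
    rewrite E, norm_opp; apply Rle_trans with (1 := norm_triangle _ _).
    assert (H3 : 7 * t * norm (N y) <= 7 * t * norm y)
      by (apply Rmult_le_compat_l; lra).
    assert (H4 : t * t * norm d <= t * norm y).
    { apply Rmult_le_compat; try nra; apply norm_ge_0. }
    lra.
Qed.

End Functionals.

Section Correction.
Context {k : scalars} {X : CompleteNormedModule (scalar_field k)}.
Notation K := (scalar_field k).

(** The AHp speaks of functionals of norm 1 with large real part at [x0], so [f] is divided by its
    norm [F] and rotated by [c]. After correction only the rotation is undone: [h] keeps norm 1, and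
    the normalization costs at most [1 - F < b]. *)
Lemma functional_correction (x0 x1 : X) (e eta b : R)
    (f : X -> AbsRing_NormedModule K) :
  sphere x0 ->
  (forall f0 : X -> AbsRing_NormedModule K,
      dual_sphere f0 -> re (f0 x0) > 1 - eta ->
      exists f1 : X -> AbsRing_NormedModule K,
        dual_sphere f1 /\ op_norm (op_sub f1 f0) < e /\ f1 x1 = one) ->
  0 < b < 1 -> b <= eta ->
  is_linear f -> (forall x, norm (f x) <= norm x) -> 1 - b < norm (f x0) ->
  exists (h : X -> AbsRing_NormedModule K) (c : K),
    is_linear h /\ (forall x, norm (h x) <= norm x) /\
    (forall x, norm (minus (h x) (f x)) <= (e + b) * norm x) /\
    abs c = 1 /\ mult c (f x0) = of_R (norm (f x0)) /\ mult c (h x1) = one.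
Proof.
intros Hx0 HX Hb Hbe Hf Hf1 Hfx.
unfold sphere in Hx0.
destruct (scalar_phase (f x0)) as [c [Hc Ec]].
destruct (unimodular_inv c Hc) as [c' [Hc' Ecc]].
set (F := op_norm f).
assert (HF1 : F <= 1).
{ apply op_norm_le; intros x Hx; generalize (Hf1 x); lra. }
assert (HF : forall x, norm (f x) <= F * norm x) by (intros x; now apply op_norm_ub).
assert (HF0 : norm (f x0) <= F) by (generalize (HF x0); rewrite Hx0; lra).
assert (HFi : 0 < / F) by (apply Rinv_0_lt_compat; lra).
set (f0 := fun x => mult (mult (of_R (/ F)) c) (f x) : AbsRing_NormedModule K).
assert (Hf0 : forall x, norm (f0 x) = / F * norm (f x)).
{ intros x; unfold f0; change (norm (K := K)) with (abs (K := K)).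
  rewrite !abs_mult_eq, Hc, abs_of_R, Rabs_pos_eq by lra; ring. }
assert (Lf0 : is_linear f0) by now apply is_linear_mult.
assert (D0 : dual_sphere f0).
{ split; [exact Lf0 |]; apply Rle_antisym.
  - apply op_norm_le; intros x Hx; rewrite Hf0.
    rewrite <- (Rinv_l F) by lra; apply Rmult_le_compat_l; [lra |].
    generalize (HF x); nra.
  (* The lower bound on the norm of [f0] comes from scaling back: [F * op_norm f0] bounds [f] on the
     unit ball, hence is at least [F]. *)
  - apply Rmult_le_reg_l with F; [lra |]; rewrite Rmult_1_r.
    apply op_norm_le; intros x Hx.
    assert (H := op_norm_ub f0 x Lf0); rewrite Hf0 in H.
    apply Rmult_le_reg_l with (/ F); [exact HFi |].
    rewrite <- Rmult_assoc, Rinv_l, Rmult_1_l by lra.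
    assert (0 <= op_norm f0).
    { generalize (op_norm_ub f0 x0 Lf0) (norm_ge_0 (f0 x0)); rewrite Hx0; lra. }
    nra. }
assert (R0 : re (f0 x0) > 1 - eta).
{ unfold f0; rewrite <- mult_assoc, Ec, <- of_R_mult, re_of_R.
  change (abs (f x0 : K)) with (norm (f x0)).
  assert (1 <= / F) by (rewrite <- Rinv_1; apply Rinv_le_contravar; lra).
  generalize (norm_ge_0 (f x0)); nra. }
destruct (HX f0 D0 R0) as [h' [[Lh' Nh'] [Hh' Eh']]].
exists (fun x => mult c' (h' x)), c; split; [| split; [| split; [| split; [| split]]]].
- now apply is_linear_mult.
- intros x; change (abs (mult c' (h' x)) <= norm x).
  rewrite abs_mult_eq, Hc'; generalize (op_norm_ub h' x Lh'); rewrite Nh'.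
  change (norm (h' x)) with (abs (h' x : K)); lra.
- intros x.
  (* The first difference is the AHp error, below [e]; the second is [(/ F - 1)] times a rotation of
     [f], of norm at most [1 - F]. *)
  assert (E : minus (mult c' (h' x)) (f x : K) =
    mult c' (plus (minus (h' x : K) (f0 x)) (minus (f0 x : K) (mult c (f x))))).
  { rewrite <- (minus_trans (G := K)).
    unfold minus; rewrite (mult_distr_l (K := K)); f_equal.
    rewrite <- (opp_mult_r (K := K)), mult_assoc, Ecc, mult_one_l; reflexivity. }
  change (abs (minus (mult c' (h' x)) (f x : K)) <= (e + b) * norm x).
  rewrite E, abs_mult_eq, Hc', Rmult_1_l.
  apply Rle_trans with (1 := abs_triangle _ _).
  rewrite Rmult_plus_distr_r; apply Rplus_le_compat.
  + apply Rle_trans with (1 := op_norm_ub _ x (is_linear_op_sub _ _ Lh' Lf0)).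
    apply Rmult_le_compat_r; [apply norm_ge_0 | lra].
  + replace (minus (f0 x : K) (mult c (f x))) with
      (mult (of_R (/ F - 1)) (mult c (f x))).
    * rewrite !abs_mult_eq, Hc, abs_of_R, Rmult_1_l.
      assert (1 <= / F) by (rewrite <- Rinv_1; apply Rinv_le_contravar; lra).
      rewrite Rabs_pos_eq by lra.
      apply Rle_trans with ((/ F - 1) * (F * norm x)).
      { apply Rmult_le_compat_l; [lra | apply HF]. }
      replace ((/ F - 1) * (F * norm x)) with ((1 - F) * norm x) by (field; lra).
      apply Rmult_le_compat_r; [apply norm_ge_0 | lra].
    * rewrite of_R_minus, of_R_1; unfold minus, f0.
      rewrite (mult_distr_r (K := K)), <- (opp_mult_l (K := K)), mult_one_l.
      now rewrite mult_assoc.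
- exact Hc.
- exact Ec.
- rewrite Eh', mult_one_r, mult_scalar_comm; exact Ecc.
Qed.

End Correction.

(** * The new operator and functional for the pair *)

Lemma sequence_choice {B : Type} (P : nat -> B -> Prop) :
  (forall n, exists x, P n x) -> exists u : nat -> B, forall n, P n (u n).
Proof.
intros H; exists (fun n => proj1_sig (constructive_indefinite_description _ (H n))).
intros n; exact (proj2_sig (constructive_indefinite_description _ (H n))).
Qed.

Theorem theorem3p11 (k : scalars) (X : CompleteNormedModule (scalar_field k)) :
  AHp X -> BPBZp X (linf k).
Proof.
intros HX eps Heps.
destruct (HX (eps / 3)) as [eta [Heta HX1]]; [lra |].
(* The functional will move by at most [8 * t] and the operator by at most [eps / 3 + b], both below
   [eps]; the bound by [eta] permits the AHp, and 1/2 keeps [t] and [b] below 1. Two losses of size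
   [b] must fit into [t * t], whence [b], and cutting to the large coordinates requires the deficit
   [b * b]. *)
set (t := Rmin (1 / 2) (Rmin eta (eps / 30))).
assert (Ht : 0 < t /\ t <= 1 / 2 /\ t <= eta /\ t <= eps / 30).
{ unfold t, Rmin; repeat destruct Rle_dec; lra. }
set (b := t * t / 2).
assert (Hb : 0 < b < 1 /\ b <= t) by (unfold b; nra).
exists (b * b); split; [nra |].
intros T g0 x0 LT NT [Lg0 Ng0] Hx0 Hg0.
(* The point [x1] is fixed before any functional is considered, so it serves all coordinates of [T]
   at once. *)
destruct (HX1 x0 Hx0) as [x1 [Hx1 [Hx10 HX2]]].
unfold sphere in Hx0, Hx1.
set (f := fun n x => coord (T x : linf_NormedModule (scalar_field k)) n : AbsRing_NormedModule (scalar_field k)).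
assert (HT : forall x, norm (T x) <= norm x).
{ intros x; generalize (op_norm_ub T x LT); rewrite NT; lra. }
assert (Hf : forall n x, norm (f n x) <= norm x).
{ intros n x; apply Rle_trans with (2 := HT x).
  exact (coord_le_norm (scalar_field k) (T x : linf_NormedModule (scalar_field k)) n). }
assert (Lf : forall n, is_linear (f n)).
{ intros n; apply contraction_is_linear; [| | apply Hf].
  - intros x y; unfold f; rewrite (linear_plus T LT); reflexivity.
  - intros c x; unfold f; rewrite (linear_scal T LT); reflexivity. }
set (A := fun n => if Rlt_dec (1 - b) (norm (f n x0)) then true else false).
assert (Hn : forall n, exists p : (X -> AbsRing_NormedModule (scalar_field k)) * scalar_field k * scalar_field k,
  let '(h, c, c') := p in
    is_linear h /\ (forall x, norm (h x) <= norm x) /\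
    (forall x, norm (minus (h x) (f n x)) <= (eps / 3 + b) * norm x) /\
    abs c = 1 /\ abs c' = 1 /\ mult c' c = one /\
    (A n = true ->
       mult c (f n x0) = of_R (norm (f n x0)) /\ mult c (h x1) = one)).
{ intros n; unfold A; destruct Rlt_dec as [H | H].
  - destruct (functional_correction x0 x1 (eps / 3) eta b (f n))
      as [h [c [H1 [H2 [H3 [H4 [H5 H6]]]]]]]; try easy; [lra |].
    destruct (unimodular_inv c H4) as [c' [H7 H8]].
    now exists (h, c, c').
  (* Off [A] the coordinate functional is kept; the phases there need only be unimodular and
     mutually inverse. *)
  - exists (f n, one, one); repeat split; try easy; try apply Lf; try apply Hf.
    + intros x; rewrite minus_eq_zero.
      apply Rle_trans with 0; [exact (Req_le _ _ abs_zero) |].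
      apply Rmult_le_pos; [lra | apply norm_ge_0].
    + apply abs_one.
    + apply abs_one.
    + apply mult_one_l. }
destruct (sequence_choice _ Hn) as [p Hp].

set (h := fun n => fst (fst (p n))).
set (c := fun n => snd (fst (p n))).
set (c' := fun n => snd (p n)).
assert (Hq : forall n,
    is_linear (h n) /\ (forall x, norm (h n x) <= norm x) /\
    (forall x, norm (minus (h n x) (f n x)) <= (eps / 3 + b) * norm x) /\
    abs (c n) = 1 /\ abs (c' n) = 1 /\ mult (c' n) (c n) = one /\
    (A n = true -> mult (c n) (f n x0) = of_R (norm (f n x0)) /\
       mult (c n) (h n x1) = one)).
{ intros n; generalize (Hp n); unfold h, c, c'; destruct (p n) as [[? ?] ?]; auto. }
clearbody h c c'; clear p Hp Hn.
assert (Lh : forall n, is_linear (h n)) by (intros n; apply Hq).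
assert (Hh : forall n x, norm (h n x) <= norm x) by (intros n; apply Hq).
assert (Hhf : forall n x, norm (minus (h n x) (f n x)) <= (eps / 3 + b) * norm x)
  by (intros n; apply Hq).
assert (Hc : forall n, abs (c n) = 1) by (intros n; apply Hq).
assert (Hc' : forall n, abs (c' n) = 1) by (intros n; apply Hq).
assert (Hcc : forall n, mult (c' n) (c n) = one) by (intros n; apply Hq).
assert (HA : forall n, A n = true -> mult (c n) (f n x0) = of_R (norm (f n x0)) /\
  mult (c n) (h n x1) = one) by (intros n; apply Hq).
clear Hq.
assert (Bh : forall x, bounded_seq (fun n => h n x : scalar_field k)).
{ intros x; exists (norm x); intros n; apply Hh. }
set (S := fun x => exist _ _ (Bh x) : linf_NormedModule (scalar_field k)).
assert (HS : forall x, norm (S x) <= norm x).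
{ intros x; apply (linf_norm_le (scalar_field k)); intros n; apply Hh. }
assert (LS : is_linear S).
{ apply contraction_is_linear; [| | exact HS].
  - intros x y; apply linf_ext; intros n; apply (linear_plus (h n) (Lh n)).
  - intros a x; apply linf_ext; intros n; apply (linear_scal (h n) (Lh n)). }
set (v := T x0 : linf_NormedModule (scalar_field k)).
(* The hypothesis bounds a modulus, while the estimates use real parts: [d] rotates [g0]
   accordingly, and [d'] restores it at the end. *)
destruct (scalar_phase (g0 v)) as [d [Hd Ed]].
destruct (unimodular_inv d Hd) as [d' [Hd' Edd]].
assert (Hg0le : forall y : linf_NormedModule (scalar_field k),
  norm (g0 y) <= norm y).
{ intros y; generalize (op_norm_ub g0 y Lg0); rewrite Ng0, Rmult_1_l; auto. }
set (g := fun y : linf_NormedModule (scalar_field k) =>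
  mult d (g0 y) : AbsRing_NormedModule (scalar_field k)).
assert (Lg : is_linear g) by exact (is_linear_mult d g0 Lg0).
assert (Hgle : forall y, norm (g y) <= norm y).
{ intros y; apply Rle_trans with (2 := Hg0le y).
  apply Rle_trans with (1 := abs_mult _ _); rewrite Hd, Rmult_1_l; apply Rle_refl. }
assert (Hv : norm v <= 1) by (rewrite <- Hx0; apply HT).
assert (Hgv : 1 - b * b <= re (g v)).
{ unfold g; rewrite Ed, re_of_R; apply Rlt_le, Hg0. }
assert (Bw : bounded_seq (fun n => if A n then c' n else zero)).
{ exists 1; intros n; destruct (A n); [rewrite Hc' | rewrite abs_zero]; lra. }
assert (Bv : bounded_seq (fun n => if A n then coord v n else zero)).
{ exists 1; intros n; destruct (A n); [| rewrite abs_zero; lra].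
  apply Rle_trans with (2 := Hv); exact (coord_le_norm _ v n). }
(* On [A], [c' n] is the phase of [f n x0] and also the value [h n x1]. So [w] is [S x1] cut to [A],
   and it differs from [v] cut to [A] only in moduli, which lie between [1 - b] and 1. *)
set (w := exist _ _ Bw : linf_NormedModule (scalar_field k)).
set (vA := exist _ _ Bv : linf_NormedModule (scalar_field k)).
assert (HgvA : 1 - b <= re (g vA)).
{ apply (functional_large_coordinates g Lg Hgle v); auto; [lra |].
  intros n; change (coord vA n) with (if A n then coord v n else zero).
  unfold A; destruct Rlt_dec as [H | H]; [now left | right].
  split; [reflexivity | exact (Rnot_lt_le _ _ H)]. }
assert (Hvw : norm (minus vA w) <= b).
{ apply (linf_norm_le (scalar_field k)); intros n; rewrite coord_minus.
  change (coord vA n) with (if A n then coord v n else zero).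
  change (coord w n) with (if A n then c' n else zero).
  destruct (A n) eqn:En.
  - rewrite <- (Rmult_1_l (abs _)), <- (Hc n), <- abs_mult_eq.
    replace (mult (c n) (minus (coord v n) (c' n)))
      with (of_R (norm (f n x0) - 1) : scalar_field k).
    + rewrite abs_of_R; unfold A in En; destruct Rlt_dec as [H | H]; [| easy].
      generalize (Hf n x0); rewrite Hx0; intros H'; rewrite Rabs_left1; lra.
    + rewrite of_R_minus, <- (proj1 (HA n En)), of_R_1, <- (Hcc n).
      unfold minus; rewrite (mult_distr_l (K := scalar_field k)); f_equal.
      now rewrite <- (opp_mult_r (K := scalar_field k)), (mult_scalar_comm (c n)).
  - rewrite (minus_eq_zero (G := scalar_field k)).
    apply Rle_trans with 0; [exact (Req_le _ _ abs_zero) | lra]. }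
(* One [b] is lost by cutting [v] to [A], another by passing from [vA] to [w]. *)
assert (Hgw : 1 - t * t <= re (g w)).
{ assert (H := re_functional_le g Hgle (minus vA w)).
  rewrite (linear_minus g _ _ Lg) in H.
  change (re (plus (g vA : scalar_field k) (opp (g w : scalar_field k)))
    <= norm (minus vA w)) in H.
  rewrite re_add, re_neg in H; unfold b in *; lra. }
destruct (norming_functional_near g Lg Hgle A c c' w t)
  as [g1 [Lg1 [Hg1 [Eg1 Cg1]]]]; auto; [lra |].
assert (ES : g1 (S x1) = one) by (apply Eg1; intros n Hn; now apply HA).
set (g2 := fun y : linf_NormedModule (scalar_field k) =>
  mult d' (g1 y) : AbsRing_NormedModule (scalar_field k)).
assert (Lg2 : is_linear g2) by exact (is_linear_mult d' g1 Lg1).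
assert (Hg2 : forall y, norm (g2 y) <= norm y).
{ intros y; apply Rle_trans with (2 := Hg1 y).
  apply Rle_trans with (1 := abs_mult _ _); rewrite Hd', Rmult_1_l; apply Rle_refl. }
assert (E2 : norm (g2 (S x1)) = 1).
{ unfold g2; rewrite ES, mult_one_r; exact Hd'. }
assert (NS : norm (S x1) = 1).
{ apply Rle_antisym; [rewrite <- Hx1; apply HS | rewrite <- E2; apply Hg2]. }
exists g2, x1, S; split; [| split; [| split; [| split; [| split; [| split; [| split]]]]]].
- split; [exact Lg2 | exact (op_norm_eq_1 g2 (S x1) Lg2 Hg2 NS E2)].
- exact Hx1.
- exact LS.
- exact (op_norm_eq_1 S x1 LS HS Hx1 NS).
- exact E2.
- lra.
- apply Rle_lt_trans with (8 * t); [| lra].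
  apply op_norm_le; intros y Hy; unfold op_sub, g2.
  assert (E : minus (mult d' (g1 y)) (g0 y : scalar_field k) =
    mult d' (minus (g1 y : scalar_field k) (g y))).
  { unfold minus, g; rewrite (mult_distr_l (K := scalar_field k)); f_equal.
    now rewrite <- (opp_mult_r (K := scalar_field k)), mult_assoc, Edd, mult_one_l. }
  change (abs (minus (mult d' (g1 y)) (g0 y : scalar_field k)) <= 8 * t).
  rewrite E, abs_mult_eq, Hd', Rmult_1_l.
  apply Rle_trans with (1 := Cg1 y).
  rewrite <- (Rmult_1_r (8 * t)) at 2; apply Rmult_le_compat_l; [lra | exact Hy].
- apply Rle_lt_trans with (eps / 3 + b); [| lra].
  apply op_norm_le; intros x Hx.
  apply (linf_norm_le (scalar_field k)); intros n.
  apply Rle_trans with (1 := Hhf n x).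
  rewrite <- (Rmult_1_r (eps / 3 + b)) at 2; apply Rmult_le_compat_l; [lra | exact Hx].
Qed.
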